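(* Let $n,m,l\ge 1$ and $k\ge 0$ be integers, let $\mathbf{x}_1,\dots,\mathbf{x}_n\in\mathbb{R}^m$, let $\mathbf{Y}=(y_{ij})\in\{-1,1\}^{n\times l}$, and for each $i$ put $Y_i^+=\{j: y_{ij}=1\}$ and $Y_i^-=\{j: y_{ij}=-1\}$, both assumed nonempty. Let $\lambda_1>0$ and $\lambda_2\ge 0$ be real numbers. Let $\mathcal{H}$ be a real Hilbert space and let $\phi:\mathbb{R}^m\to\mathcal{H}$ be a mapping. Consider the optimization problem, over $l$-tuples $\mathbf{W}=[\mathbf{w}^1,\dots,\mathbf{w}^l]$ with $\mathbf{w}^j\in\mathcal{H}$, $$\min_{\mathbf{W}}\ \frac12\sum_{i=1}^n\sum_{j=1}^l \max\bigl(0,\,1-y_{ij}\langle \mathbf{w}^j,\phi(\mathbf{x}_i)\rangle\bigr)^2+\frac{\lambda_1}{2}\|\mathbf{W}\|_F^2+\frac{\lambda_2}{2}\sum_{i=1}^n\frac{1}{|Y_i^+||Y_i^-|}\sum_{p\in Y_i^+}\sum_{q\in Y_i^-}\max\bigl(0,\,2-\langle \mathbf{w}^p-\mathbf{w}^q,\phi(\mathbf{x}_i)\rangle\bigr)^2$$ $$\text{subject to } \operatorname{Rank}(\mathbf{W})\le k.$$ If this problem has a minimizer, then there exists an optimal $\mathbf{W}$ of the form $$\mathbf{W}=\Phi(\mathbf{X})^\top\mathbf{A}\quad\text{with } \mathbf{A}\in\mathbb{R}^{n\times l},\ \operatorname{Rank}(\mathbf{A})\le k.$$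
   Context: For $\mathbf{W}=[\mathbf{w}^1,\dots,\mathbf{w}^l]$ with columns $\mathbf{w}^j\in\mathcal{H}$: $\|\mathbf{W}\|_F^2=\sum_{j=1}^l\|\mathbf{w}^j\|_{\mathcal{H}}^2$, and $\operatorname{Rank}(\mathbf{W})$ is the dimension of the linear span of $\mathbf{w}^1,\dots,\mathbf{w}^l$ in $\mathcal{H}$. $\Phi(\mathbf{X})=[\phi(\mathbf{x}_1);\dots;\phi(\mathbf{x}_n)]$ is the data matrix in $\mathcal{H}$ with rows $\phi(\mathbf{x}_i)$, and $\mathbf{W}=\Phi(\mathbf{X})^\top\mathbf{A}$ means $\mathbf{w}^j=\sum_{i=1}^n \mathbf{A}_{ij}\,\phi(\mathbf{x}_i)$ for every $j=1,\dots,l$. $|\cdot|$ applied to a set is its cardinality. *)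

(* Defs.v *)
From HB Require Import structures.
From mathcomp Require Import all_boot all_order all_algebra.
From mathcomp Require Import all_classical all_reals all_analysis.
Import Order.TTheory GRing.Theory Num.Theory.
Import numFieldNormedType.Exports.

Set Implicit Arguments.
Unset Strict Implicit.
Unset Printing Implicit Defensive.

Local Open Scope classical_set_scope.
Local Open Scope ring_scope.

Section LinearSpan.
Context {R : realType} {H : lmodType R}.

Definition lin_span (l : nat) (W : 'I_l -> H) : set H :=
  [set v | exists c : 'I_l -> R, v = \sum_(j < l) c j *: W j].

Definition lin_indep (l : nat) (W : 'I_l -> H) : Prop :=
  forall c : 'I_l -> R, \sum_(j < l) c j *: W j = 0 -> forall j, c j = 0.

Definition has_dim (S : set H) (d : nat) : Prop :=
  exists b : 'I_d -> H, lin_indep b /\ lin_span b = S.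

(* The default value 0 of [xget] is never reached: the dimension of the span
   exists and is unique, see [span_rankP]. *)
Definition span_rank (l : nat) (W : 'I_l -> H) : nat :=
  xget 0%N [set d | has_dim (lin_span W) d].

Lemma has_dim_lin_span (l : nat) (W : 'I_l -> H) :
  exists d, has_dim (lin_span W) d.
Proof.
elim: l W => [|l IH] W.
  by exists 0%N, W; split=> // c _ [].
have [Wf|] := pselect (lin_indep W); first by exists l.+1, W.
move=> /existsNP[c /not_implyP[cW /existsNP[j /eqP cj]]].
have [d [b [bf bS]]] := IH (fun i => W (lift j i)).
exists d, b; split=> //; rewrite bS; apply/seteqP; split=> v /= [a ->].
  exists (fun i => if unlift j i is Some i' then a i' else 0).
  rewrite [RHS](bigD1_ord j) //= unlift_none scale0r add0r.
  by apply: eq_bigr => i _; rewrite liftK.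
have Wj : W j = \sum_(i < l) (- (c j)^-1 * c (lift j i)) *: W (lift j i).
  move: cW; rewrite (bigD1_ord j) //= => /eqP; rewrite addr_eq0 => /eqP cW.
  apply: (scalerI cj); rewrite cW -sumrN scaler_sumr; apply: eq_bigr => i _.
  by rewrite scalerA mulNr mulrN mulrA divff // mul1r scaleNr.
exists (fun i => a j * (- (c j)^-1 * c (lift j i)) + a (lift j i)).
rewrite (bigD1_ord j) //= [in LHS]Wj scaler_sumr -big_split /=.
by apply: eq_bigr => i _; rewrite scalerA -scalerDl.
Qed.

Lemma has_dim_le (S : set H) (d e : nat) :
  has_dim S d -> has_dim S e -> (d <= e)%N.
Proof.
move=> [b [bf bS]] [b' [_ b'S]].
have bb' i : exists c : 'I_e -> R, b i = \sum_(j < e) c j *: b' j.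
  suff : lin_span b' (b i) by [].
  rewrite b'S -bS; exists (fun j => (j == i)%:R).
  rewrite (bigD1 i) //= eqxx scale1r big1 ?addr0 // => j /negbTE ->.
  by rewrite scale0r.
have [M MP] := choice bb'.
pose A : 'M[R]_(d, e) := \matrix_(i, j) M i j.
suff : row_free A by move=> /eqP <-; exact: rank_leq_col.
rewrite -kermx_eq0; apply/eqP/row_matrixP => r; rewrite row0.
set u := row r _.
have uA : u *m A = 0 by rewrite -row_mul mulmx_ker row0.
apply/rowP => i; rewrite [RHS]mxE; apply: (bf (fun i => u 0 i)) => {i}.
under eq_bigr do rewrite MP scaler_sumr.
rewrite exchange_big /= big1 // => j _.
under eq_bigr do rewrite scalerA.
rewrite -scaler_suml.
have /rowP/(_ j) := uA; rewrite !mxE => uAj.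
under eq_bigr => i _.
  have -> : M i j = A i j by rewrite mxE.
  over.
by rewrite uAj scale0r.
Qed.

Lemma span_rankP (l : nat) (W : 'I_l -> H) (d : nat) :
  has_dim (lin_span W) d <-> span_rank W = d.
Proof.
have rW : has_dim (lin_span W) (span_rank W).
  by have [e eP] := has_dim_lin_span W; rewrite /span_rank; case: xgetP => // /(_ e).
split=> [dP|<- //]; apply/eqP; rewrite eqn_leq.
by rewrite (has_dim_le rW dP) (has_dim_le dP rW).
Qed.

End LinearSpan.

Section Problem.
Context {R : realType}.

Definition pos_labels (n l : nat) (Y : 'M[R]_(n, l)) (i : 'I_n) : {set 'I_l} :=
  [set j | Y i j == 1]%SET.

Definition neg_labels (n l : nat) (Y : 'M[R]_(n, l)) (i : 'I_n) : {set 'I_l} :=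
  [set j | Y i j == -1]%SET.

Context {H : completeNormedModType R}.

Definition frob_sq (l : nat) (W : 'I_l -> H) : R := \sum_(j < l) `|W j| ^+ 2.

Definition objective (ip : H -> H -> R) (n m l : nat) (phi : 'rV[R]_m -> H)
    (x : 'I_n -> 'rV[R]_m) (Y : 'M[R]_(n, l)) (lambda1 lambda2 : R)
    (W : 'I_l -> H) : R :=
  1 / 2 * (\sum_(i < n) \sum_(j < l)
    Num.max 0 (1 - Y i j * ip (W j) (phi (x i))) ^+ 2)
  + lambda1 / 2 * frob_sq W
  + lambda2 / 2 * (\sum_(i < n)
      1 / (#|pos_labels Y i|%:R * #|neg_labels Y i|%:R) *
      (\sum_(p in pos_labels Y i) \sum_(q in neg_labels Y i)
        Num.max 0 (2 - ip (W p - W q) (phi (x i))) ^+ 2)).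

Definition optimal (ip : H -> H -> R) (n m l k : nat) (phi : 'rV[R]_m -> H)
    (x : 'I_n -> 'rV[R]_m) (Y : 'M[R]_(n, l)) (lambda1 lambda2 : R)
    (W : 'I_l -> H) : Prop :=
  (span_rank W <= k)%N /\
  forall V : 'I_l -> H, (span_rank V <= k)%N ->
    objective ip phi x Y lambda1 lambda2 W
      <= objective ip phi x Y lambda1 lambda2 V.

(* [Phi(X)^T A], as the family of its columns. *)
Definition trPhi_mul (n m l : nat) (phi : 'rV[R]_m -> H)
    (x : 'I_n -> 'rV[R]_m) (A : 'M[R]_(n, l)) : 'I_l -> H :=
  fun j => \sum_(i < n) A i j *: phi (x i).

End Problem.

(* Main.v *)
(* Projecting the columns of a minimizer W orthogonally onto the span of the
   phi(x_i) leaves all the inner products <w^j, phi(x_i)> unchanged and does not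
   increase the norms, so the result is again optimal.  If G is the Gram matrix
   of the phi(x_i) and P = (<w^j, phi(x_i)>)_{j,i}, the projection is
   Phi(X)^T A with A^T = P G^-, where G^- is a partial inverse of G; the rank
   of A is at most that of P, which is at most that of W. *)
Require Import Defs.
From HB Require Import structures.
From mathcomp Require Import all_boot all_order all_algebra.
From mathcomp Require Import all_classical all_reals all_analysis.
Import Order.TTheory GRing.Theory Num.Theory.
Import numFieldNormedType.Exports.

Set Implicit Arguments.
Unset Strict Implicit.
Unset Printing Implicit Defensive.

Local Open Scope ring_scope.

Lemma lin_span_mem (R : realType) (H : lmodType R) (l : nat) (W : 'I_l -> H)
    (j : 'I_l) : lin_span W (W j).
Proof.
exists (fun i => (i == j)%:R).
rewrite (bigD1 j) //= eqxx scale1r big1 ?addr0 // => i /negbTE ->.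
by rewrite scale0r.
Qed.

(** A basis [b] of the span is expressed through the [V j] by a matrix [B]. A row vector killing
    [B *m M] gives a linear relation among the [b i], hence vanishes; so [B *m M] has full row
    rank. *)
Lemma span_rank_lin_comb (R : realType) (H : lmodType R) (l e : nat)
    (M : 'M[R]_(l, e)) (c : 'I_e -> H) :
  (span_rank (fun j => \sum_(t < e) M j t *: c t)%R <= \rank M)%N.
Proof.
set V := fun j => _.
have [b [bf bS]] := (span_rankP V (span_rank V)).2 erefl.
have bV i : exists a : 'I_l -> R, b i = \sum_(j < l) a j *: V j.
  suff : lin_span V (b i) by [].
  by rewrite -bS; exact: lin_span_mem.
have [N NP] := choice bV.
pose B : 'M[R]_(span_rank V, l) := \matrix_(i, j) N i j.
suff /eqP <- : row_free (B *m M) by exact: mxrankM_maxr.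
rewrite -kermx_eq0; apply/eqP/row_matrixP => r; rewrite row0.
set u := row r _.
have uBM : u *m B *m M = 0 by rewrite -mulmxA -row_mul mulmx_ker row0.
apply/rowP => i; rewrite [RHS]mxE; apply: (bf (fun i => u 0 i)) => {i}.
transitivity (\sum_(j < l) (u *m B) 0 j *: V j).
  under eq_bigr do rewrite NP scaler_sumr.
  rewrite exchange_big /=; apply: eq_bigr => j _.
  rewrite mxE scaler_suml; apply: eq_bigr => i _.
  by rewrite [B _ _]mxE scalerA.
transitivity (\sum_(t < e) (u *m B *m M) 0 t *: c t).
  under eq_bigr do rewrite scaler_sumr.
  rewrite exchange_big /=; apply: eq_bigr => t _.
  by rewrite [in RHS]mxE scaler_suml; apply: eq_bigr => j _; rewrite scalerA.
by rewrite uBM big1 // => t _; rewrite mxE scale0r.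
Qed.

Section InnerProduct.
Context (R : realType) (H : lmodType R) (ip : {dot H for idfun}).

(** Expanding each [W j] in a basis of the span factors the matrix through dimension
    [span_rank W]. *)
Lemma rank_ip_mx_le (l n : nat) (W : 'I_l -> H) (u : 'I_n -> H) :
  (\rank (\matrix_(j < l, i < n) ip (W j) (u i)) <= span_rank W)%N.
Proof.
have [b [_ bS]] := (span_rankP W (span_rank W)).2 erefl.
have Wb j : exists a : 'I_(span_rank W) -> R, W j = \sum_(r < _) a r *: b r.
  suff : lin_span b (W j) by [].
  by rewrite bS; exact: lin_span_mem.
have [N NP] := choice Wb.
pose B : 'M[R]_(l, span_rank W) := \matrix_(j, r) N j r.
have -> : \matrix_(j < l, i < n) ip (W j) (u i) =
    B *m \matrix_(r < _, i < n) ip (b r) (u i).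
  apply/matrixP => j i; rewrite !mxE NP linear_sumlz /=.
  by apply: eq_bigr => r _; rewrite linearZl_LR !mxE.
exact: leq_trans (mxrankM_maxl _ _) (rank_leq_col _).
Qed.

Lemma orthogonal_projection_mx (l n : nat) (W : 'I_l -> H) (u : 'I_n -> H) :
    (forall v : H, ip v v = 0 -> v = 0) ->
  exists2 A : 'M[R]_(n, l), (\rank A <= span_rank W)%N &
    forall j i, ip (\sum_(i < n) A i j *: u i) (u i) = ip (W j) (u i).
Proof.
move=> ip_def.
pose G := \matrix_(i < n, i' < n) ip (u i) (u i').
pose P := \matrix_(j < l, i < n) ip (W j) (u i).
(* This makes the normal equations [A^T *m G = P] solvable. A column of [cokermx G] gives a
   combination [v] of the [u i] orthogonal to every [u i], hence to itself; so [v = 0], and [P]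
   kills that column too. *)
have PG : (P <= G)%MS.
  rewrite submxE; apply/eqP/matrixP => j t; rewrite [RHS]mxE.
  pose v := \sum_(i < n) cokermx G i t *: u i.
  have ip_v w : ip w v = \sum_(i < n) ip w (u i) * cokermx G i t.
    by rewrite linear_sumr; apply: eq_bigr => i _; rewrite linearZr_LR /= mulrC.
  have uv i : ip (u i) v = 0.
    transitivity ((G *m cokermx G) i t); last by rewrite mulmx_coker mxE.
    by rewrite ip_v mxE; apply: eq_bigr => i' _; rewrite [G _ _]mxE.
  have v0 : v = 0.
    apply: ip_def; rewrite {1}/v linear_sumlz big1 // => i _.
    by rewrite linearZl_LR /= uv mulr0.
  have := ip_v (W j); rewrite v0 linear0r => ->.
  by rewrite mxE; apply: eq_bigr => i _; rewrite [P _ _]mxE.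
exists (P *m pinvmx G)^T.
  by rewrite mxrank_tr; exact: leq_trans (mxrankM_maxl _ _) (rank_ip_mx_le _ _).
move=> j i; transitivity ((P *m pinvmx G *m G) j i); last by rewrite mulmxKpV // mxE.
rewrite linear_sumlz [RHS]mxE.
by apply: eq_bigr => i' _; rewrite linearZl_LR /= [_^T _ _]mxE [G _ _]mxE.
Qed.

End InnerProduct.

(* MathComp / MathComp-Analysis world. A real Hilbert space is a complete
   normed module over R whose norm is induced by the inner product [ip]. *)
Theorem theorem1 (R : realType) (n m l k : nat)
  (hn : (1 <= n)%N) (hm : (1 <= m)%N) (hl : (1 <= l)%N)
  (x : 'I_n -> 'rV[R]_m)
  (Y : 'M[R]_(n, l)) (hY : forall i j, Y i j = -1 \/ Y i j = 1)
  (hYpos : forall i, pos_labels Y i != finset.set0)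
  (hYneg : forall i, neg_labels Y i != finset.set0)
  (lambda1 lambda2 : R) (hlambda1 : 0 < lambda1) (hlambda2 : 0 <= lambda2)
  (H : completeNormedModType R) (ip : {dot H for idfun})
  (norm_ip : forall u : H, `|u| ^+ 2 = ip u u)
  (phi : 'rV[R]_m -> H) :
  (exists W : 'I_l -> H, optimal ip k phi x Y lambda1 lambda2 W) ->
  exists A : 'M[R]_(n, l),
    (\rank A <= k)%N /\
    optimal ip k phi x Y lambda1 lambda2 (trPhi_mul phi x A).
Proof.
move=> [W [Wk Wopt]].
have ip_def v : ip v v = 0 -> v = 0.
  by rewrite -norm_ip => /eqP; rewrite sqrf_eq0 normr_eq0 => /eqP.
have [A rA AP] := orthogonal_projection_mx W (phi \o x) ip_def.
have rAk := leq_trans rA Wk; exists A; split=> //; split.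
  rewrite -mxrank_tr in rAk; apply: leq_trans rAk.
  have -> : trPhi_mul phi x A = fun j => \sum_(i < n) A^T j i *: phi (x i).
    by apply/funext => j; apply: eq_bigr => i _; rewrite mxE.
  exact: span_rank_lin_comb.
move=> V /Wopt; apply: le_trans.
have normP j : `|trPhi_mul phi x A j| ^+ 2 <= `|W j| ^+ 2.
  set p := trPhi_mul phi x A j; rewrite -[W j](subrK p) !norm_ip.
  (* The residual [W j - p] is orthogonal to every [phi (x i)], hence to their combination [p];
     Pythagoras then bounds the norm of [p]. *)
  have Wp0 : ip (W j - p) p = 0.
    rewrite {2}/p linear_sumr big1 // => i _.
    by rewrite linearZr_LR /= linearBl /= -[p]/(\sum_(i < n) _) AP subrr mulr0.
  by rewrite hnormDd // lerDr; have := sqr_ge0 `|W j - p|; rewrite norm_ip.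
(* Both loss terms see the columns only through their inner products with the [phi (x i)], so they
   are unchanged; only the Frobenius term can drop. *)
rewrite /objective lerD ?lerD //.
- rewrite le_eqVlt; apply/orP; left; apply/eqP; congr (_ * _).
  by apply: eq_bigr => i _; apply: eq_bigr => j _; rewrite AP.
- by apply: ler_wpM2l; [rewrite divr_ge0 ?ltW | exact: ler_sum].
- rewrite le_eqVlt; apply/orP; left; apply/eqP; congr (_ * _).
  apply: eq_bigr => i _; congr (_ * _).
  by apply: eq_bigr => p _; apply: eq_bigr => q _; rewrite !linearBl /= !AP.
Qed.
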